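(* The sequence $\{C_n\}_{n\geq 1}$ of Catalan numbers $C_n=\frac{1}{n+1}\binom{2n}{n}$ is infinitely log-monotonic.
   Context: For a sequence $(x_n)_{n\ge m}$ of positive reals: it is log-concave (resp. log-convex) if $x_n^2\ge x_{n-1}x_{n+1}$ (resp. $x_n^2\le x_{n-1}x_{n+1}$) for all $n\ge m+1$. The operator $\mathcal R$ sends $(x_n)_{n\ge m}$ to $(x_{n+1}/x_n)_{n\ge m}$. The sequence is log-monotonic of order $k$ if for every integer $r$ with $0\le r\le k-1$, $\mathcal R^r(x_n)$ is log-convex when $r$ is even and log-concave when $r$ is odd. It is infinitely log-monotonic if it is log-monotonic of order $k$ for every integer $k\ge 1$. *)

(* Defs.v *)
From mathcomp Require Import all_boot all_order all_algebra.
From mathcomp Require Import reals.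

Set Implicit Arguments.
Unset Strict Implicit.
Unset Printing Implicit Defensive.

Import Order.TTheory GRing.Theory Num.Theory.
Local Open Scope ring_scope.

(* A sequence (x_n)_{n >= m} is given by a total function x : nat -> R together
   with its starting index m; none of the predicates below depends on the
   values x n for n < m. *)

Definition log_concave (R : realType) (m : nat) (x : nat -> R) : Prop :=
  forall n : nat, (m.+1 <= n)%N -> x n.-1 * x n.+1 <= x n ^+ 2.

Definition log_convex (R : realType) (m : nat) (x : nat -> R) : Prop :=
  forall n : nat, (m.+1 <= n)%N -> x n ^+ 2 <= x n.-1 * x n.+1.

Definition ratio_seq (R : realType) (x : nat -> R) : nat -> R :=
  fun n => x n.+1 / x n.

(* The first conjunct is the standing assumption that the terms are positive;
   it makes every quotient taken by ratio_seq from index m on a genuine one. *)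
Definition log_monotonic (R : realType) (m k : nat) (x : nat -> R) : Prop :=
  (forall n : nat, (m <= n)%N -> 0 < x n) /\
  (forall r : nat, (r < k)%N ->
     if odd r then log_concave m (iter r (@ratio_seq R) x)
     else log_convex m (iter r (@ratio_seq R) x)).

Definition infinitely_log_monotonic (R : realType) (m : nat) (x : nat -> R) :
    Prop :=
  forall k : nat, (1 <= k)%N -> log_monotonic m k x.

Definition catalan (R : realType) (n : nat) : R :=
  n.+1%:R^-1 * 'C(2 * n, n)%:R.

(* Main.v *)
Require Import Defs.
From mathcomp Require Import all_boot all_order all_algebra.
From mathcomp Require Import reals.
From mathcomp Require Import all_classical topology normedtype derive realfun exp.
From mathcomp Require Import ring lra.

Set Implicit Arguments.
Unset Strict Implicit.
Unset Printing Implicit Defensive.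

Import Order.TTheory GRing.Theory Num.Theory.
Import numFieldNormedType.Exports.
Local Open Scope ring_scope.

(** Taking logarithms turns the operator [ratio_seq] into the forward
    difference, so the claim is that the sign of the difference of order [r + 2]
    of [ln C_n] is [(-1)^r].  Since
    [C_(n+1) / C_n = 4 (n + 1/2) / (n + 2)], this is a difference of order
    [r + 1] of [ln (n + 1/2) - ln (n + 2)].  For a fixed order [k], the
    difference of order [k] in [n] of [ln (n + t)] has derivative
    [(-1)^k k! / ((n + t) ... (n + t + k))] in [t], hence it is monotone in [t],
    and one compares its values at [t = 1/2] and [t = 2]. *)

Definition fdiff (V : zmodType) (u : nat -> V) : nat -> V :=
  fun n => u n.+1 - u n.

Lemma eq_iter_fdiff (V : zmodType) (u v : nat -> V) k :
  u =1 v -> iter k (@fdiff V) u =1 iter k (@fdiff V) v.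
Proof. by move=> uv; elim: k => //= k IHk n; rewrite /fdiff !IHk. Qed.

Lemma iter_fdiffB (V : zmodType) (u v : nat -> V) k n :
  iter k (@fdiff V) (fun i => u i - v i) n =
  iter k (@fdiff V) u n - iter k (@fdiff V) v n.
Proof.
by elim: k n => //= k IHk n; rewrite /fdiff !IHk !opprD !opprK addrACA.
Qed.

(** The innermost difference already cancels [c]; this disposes of the constant [ln 4]. *)
Lemma iter_fdiffS_addl (V : zmodType) (c : V) (u : nat -> V) k :
  iter k.+1 (@fdiff V) (fun i => c + u i) =1 iter k.+1 (@fdiff V) u.
Proof.
move=> n; rewrite !iterSr; apply: eq_iter_fdiff => i.
by rewrite /fdiff opprD addrACA subrr add0r.
Qed.

Section RealSequences.
Variable R : realType.
Implicit Types (x : nat -> R) (t : R).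

Lemma iter_ratio_gt0 x k : (forall n, 0 < x n) ->
  forall n, 0 < iter k (@ratio_seq R) x n.
Proof. by move=> x0; elim: k => //= k IHk n; rewrite divr_gt0. Qed.

Lemma ln_iter_ratio x k n : (forall i, 0 < x i) ->
  ln (iter k (@ratio_seq R) x n) = iter k (@fdiff R) (fun i => ln (x i)) n.
Proof.
move=> x0; elim: k n => //= k IHk n.
by rewrite /ratio_seq /fdiff ln_div ?posrE ?iter_ratio_gt0 ?IHk.
Qed.

(** The logarithm of [x n * x n.+2 / x n.+1 ^+ 2] is the second difference of [ln x] at [n]. It is
    indexed by its first term, [log_convex] by the middle one: hence [m <= n] in place of
    [m.+1 <= n]. *)
Lemma log_convexE m x : (forall n, 0 < x n) ->
  log_convex m x <->
  forall n, (m <= n)%N -> 0 <= iter 2 (@fdiff R) (fun i => ln (x i)) n.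
Proof.
move=> x0; have E n : (x n.+1 ^+ 2 <= x n * x n.+2) =
    (0 <= iter 2 (@fdiff R) (fun i => ln (x i)) n).
  rewrite -ler_ln ?posrE ?mulr_gt0 ?exprn_gt0 // lnM ?posrE // lnXn //.
  by rewrite -subr_ge0 /= /fdiff; congr (0 <= _); ring.
split=> H n mn; first by rewrite -E; apply: (H n.+1).
by case: n mn => // n mn; rewrite E; apply: H.
Qed.

Lemma log_concaveE m x : (forall n, 0 < x n) ->
  log_concave m x <->
  forall n, (m <= n)%N -> iter 2 (@fdiff R) (fun i => ln (x i)) n <= 0.
Proof.
move=> x0; have E n : (x n * x n.+2 <= x n.+1 ^+ 2) =
    (iter 2 (@fdiff R) (fun i => ln (x i)) n <= 0).
  rewrite -ler_ln ?posrE ?mulr_gt0 ?exprn_gt0 // lnM ?posrE // lnXn //.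
  by rewrite -subr_le0 /= /fdiff; congr (_ <= 0); ring.
split=> H n mn; first by rewrite -E; apply: (H n.+1).
by case: n mn => // n mn; rewrite E; apply: H.
Qed.

Lemma infinitely_log_monotonic_fdiff m x : (forall n, 0 < x n) ->
  (forall r n, (m <= n)%N ->
     0 <= (-1) ^+ r * iter r.+2 (@fdiff R) (fun i => ln (x i)) n) ->
  infinitely_log_monotonic m x.
Proof.
move=> x0 H k _; split=> // r _.
have E n : iter 2 (@fdiff R) (fun i => ln (iter r (@ratio_seq R) x i)) n =
    iter r.+2 (@fdiff R) (fun i => ln (x i)) n.
  by rewrite (eq_iter_fdiff _ (fun i => ln_iter_ratio r i x0)) -iterD.
(* The factor [(-1) ^+ r] encodes the alternation between the concave and the convex case. *)
have := H r; rewrite -signr_odd; case: (odd r) => {}H.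
  apply/log_concaveE => [|n mn]; first exact: iter_ratio_gt0.
  by have := H n mn; rewrite E expr1 mulN1r oppr_ge0.
apply/log_convexE => [|n mn]; first exact: iter_ratio_gt0.
by have := H n mn; rewrite E mul1r.
Qed.

Lemma iter_fdiff_inv t k n : 0 < t ->
  iter k (@fdiff R) (fun i => (i%:R + t)^-1) n =
  (-1) ^+ k * k`!%:R / \prod_(i < k.+1) (n%:R + t + i%:R).
Proof.
move=> t0; elim: k n => [|k IHk] n.
  by rewrite /= big_ord1 addr0 !mul1r.
have neq0 (j : nat) : n%:R + t + j%:R != 0 :> R.
  by rewrite gt_eqF // ltr_wpDr // ltr_wpDl.
rewrite /= /fdiff !IHk exprS factS natrM.
have shiftE : \prod_(i < k.+1) (n.+1%:R + t + i%:R) =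
    \prod_(i < k.+1) (n%:R + t + i.+1%:R) :> R.
  by apply: eq_bigr => i _; rewrite -!natr1; ring.
(* [P] collects the factors common to the denominators at [n] and [n.+1]. What remains is
   [1/(n+t+k+1) - 1/(n+t)], whose numerator [-(k+1)] updates the sign and the factorial. *)
set P := \prod_(i < k) (n%:R + t + i.+1%:R) : R.
have P0 : P != 0 by apply/prodf_neq0 => i _; apply: neq0.
rewrite shiftE big_ord_recr big_ord_recl /= -/P.
rewrite [in RHS]big_ord_recl [in RHS]big_ord_recr /= -/P /bump /=.
rewrite addr0; have := neq0 0; rewrite addr0 => n0.
have := neq0 k.+1; rewrite -natr1 => nk.
by field; rewrite n0 nk P0.
Qed.

(** Differentiation in [t] commutes with differences in [n], so only the derivative of [ln] is
    needed. *)
Lemma is_derive_iter_fdiff_ln t k n : 0 < t ->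
  is_derive t 1 (fun s => iter k (@fdiff R) (fun i => ln (i%:R + s)) n)
    (iter k (@fdiff R) (fun i => (i%:R + t)^-1) n).
Proof.
move=> t0; elim: k n => [|k IHk] n /=; last exact: is_deriveB.
have nt0 : 0 < n%:R + t by rewrite ltr_wpDl.
have -> : (fun s => ln (n%:R + s)) = @ln R \o shift n%:R.
  by apply/funext => s; rewrite /= addrC.
rewrite -[_^-1]mulr1; apply: is_derive1_comp; last exact: is_derive_shift.
by rewrite /= [t + _]addrC; exact: is_derive1_ln.
Qed.

Lemma iter_fdiff_ln_le (a b : R) k n : 0 < a -> a <= b ->
  (-1) ^+ k * iter k (@fdiff R) (fun i => ln (i%:R + a)) n <=
  (-1) ^+ k * iter k (@fdiff R) (fun i => ln (i%:R + b)) n.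
Proof.
move=> a0 ab; rewrite -subr_ge0 -mulrBr.
have df t : a <= t -> is_derive t 1
    (fun s => iter k (@fdiff R) (fun i => ln (i%:R + s)) n)
    (iter k (@fdiff R) (fun i => (i%:R + t)^-1) n).
  by move=> at_; apply/is_derive_iter_fdiff_ln/(lt_le_trans a0).
(* By the mean value theorem, the increment from [a] to [b] is [b - a] times the derivative at some
   [c] in [[a, b]]. *)
have [c||c + ->] := MVT_segment ab (df := fun t =>
    iter k (@fdiff R) (fun i => (i%:R + t)^-1) n)
  (f := fun s => iter k (@fdiff R) (fun i => ln (i%:R + s)) n).
- by rewrite in_itv /= => /andP[/ltW ac _]; apply: df.
- apply: derivable_within_continuous => c; rewrite in_itv /= => /andP[ac _].
  by have [] := df c ac.
rewrite in_itv /= => /andP[ac _]; have c0 := lt_le_trans a0 ac.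
(* The sign of the derivative squares away against the outer one, leaving a factorial over a product
   of nonnegative factors. *)
rewrite iter_fdiff_inv // mulrA mulr_ge0 ?subr_ge0 // !mulrA -expr2 sqrr_sign.
rewrite mul1r divr_ge0 // prodr_ge0 // => i _.
by rewrite !addr_ge0 // ltW.
Qed.

Lemma catalan_gt0 n : 0 < catalan R n.
Proof. by rewrite mulr_gt0 ?invr_gt0 ?ltr0n // bin_gt0 leq_pmull. Qed.

(** Absorption is applied twice, with the symmetry of row [2n+1] exchanging its two middle
    coefficients in between. *)
Lemma mul_bin_central n :
  (n.+1 * 'C(2 * n.+1, n.+1) = 2 * (2 * n).+1 * 'C(2 * n, n))%N.
Proof.
have -> : (2 * n.+1 = (2 * n).+2)%N by rewrite mulnS.
have E : (n.+1 * 'C((2 * n).+1, n.+1) = (2 * n).+1 * 'C(2 * n, n))%N.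
  by rewrite -mul_bin_diag.
rewrite -mul_bin_diag /=.
have -> : ('C((2 * n).+1, n) = 'C((2 * n).+1, n.+1))%N.
  rewrite -(@bin_sub _ n.+1); last by rewrite ltnS leq_pmull.
  by congr 'C(_, _); rewrite mul2n -addnn subSS addnK.
have -> : ((2 * n).+2 = 2 * n.+1)%N by rewrite mulnS.
by rewrite -mulnA E mulnA.
Qed.

Lemma catalan_ratio n :
  ratio_seq (@catalan R) n = 4 * ((n%:R + 2^-1) / (n%:R + 2)).
Proof.
have n1 : n%:R + 1 != 0 :> R by rewrite natr1 pnatr_eq0.
have n2 : n%:R + 2 != 0 :> R by rewrite -natrD addnC pnatr_eq0.
have b0 : 'C(2 * n, n)%:R != 0 :> R.
  by rewrite pnatr_eq0 -lt0n bin_gt0 leq_pmull.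
have := congr1 (fun k => k%:R : R) (mul_bin_central n).
rewrite /ratio_seq /catalan !natrM -[n.+2%:R]natr1 -[n.+1%:R]natr1.
rewrite -[(2 * n).+1%:R]natr1 natrM => E.
have -> : 'C(2 * n.+1, n.+1)%:R =
    2 * (2 * n%:R + 1) * 'C(2 * n, n)%:R / (n%:R + 1) :> R.
  by rewrite -E mulrC mulKf.
have -> : n%:R + 1 + 1 = n%:R + 2 :> R by ring.
by field; rewrite n1 n2 b0.
Qed.

Lemma fdiff_ln_catalan n :
  fdiff (fun i => ln (catalan R i)) n =
  ln 4 + (ln (n%:R + 2^-1) - ln (n%:R + 2)).
Proof.
have hp : 0 < n%:R + 2^-1 :> R by rewrite ltr_wpDl // invr_gt0.
have tp : 0 < n%:R + 2 :> R by rewrite ltr_wpDl.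
rewrite -(ln_div (x := n%:R + 2^-1)) ?posrE // -lnM ?posrE ?divr_gt0 //.
by rewrite -catalan_ratio ln_div ?posrE ?catalan_gt0.
Qed.

End RealSequences.

Theorem theorem2p3 (R : realType) : infinitely_log_monotonic 1 (@catalan R).
Proof.
apply: infinitely_log_monotonic_fdiff => [|r n _]; first exact: catalan_gt0.
rewrite iterSr (eq_iter_fdiff _ (@fdiff_ln_catalan R)) iter_fdiffS_addl.
(* Negating the goal turns [(-1) ^+ r] into [(-1) ^+ r.+1], matching the order [r.+1] of the
   remaining differences, so monotonicity applies between [1/2] and [2]. *)
rewrite iter_fdiffB -oppr_le0 -mulNr -[- (_ ^+ _)]mulN1r -exprS mulrBr subr_le0.
by apply: iter_fdiff_ln_le; rewrite ?invr_gt0 //; lra.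
Qed.
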